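(* Let $\mathbf{A}$ be a semilattice and $\theta$ a congruence on $\mathbf{A}$. Then $\theta=\theta_{\mathcal{F}_{R_{q_\theta}}}$.
   Context: A semilattice is a meet-semilattice with top. A proper filter is irreducible if it is not the intersection of two filters both different from it; $X(\mathbf{B})$ denotes the set of irreducible filters of a semilattice $\mathbf{B}$, and $\beta(a)=\{P\in X(\mathbf{A})\colon a\in P\}$. $q_\theta\colon A\to A/\theta$ is the natural map; $R_{q_\theta}\subseteq X(\mathbf{A}/\theta)\times X(\mathbf{A})$ is defined by $(Q,P)\in R_{q_\theta}$ iff $q_\theta^{-1}[Q]\subseteq P$; $\mathcal{F}_{R_{q_\theta}}=\{R_{q_\theta}(Q)\colon Q\in X(\mathbf{A}/\theta)\}$. For a family $\mathcal{F}$ of subsets of $X(\mathbf{A})$ and $U\subseteq X(\mathbf{A})$, $U^-_\mathcal{F}=\{Y\in\mathcal{F}\colon Y\cap U\ne\emptyset\}$, and $\theta_\mathcal{F}=\{(a,b)\in A^2\colon[\beta(a)^c]^-_\mathcal{F}=[\beta(b)^c]^-_\mathcal{F}\}$. *)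

(* Defs.v *)
From HB Require Import structures.
From mathcomp Require Import all_boot all_order.
From mathcomp Require Import generic_quotient.
From mathcomp Require Import boolp classical_sets.

Set Implicit Arguments.
Unset Strict Implicit.
Unset Printing Implicit Defensive.

Import Order.TTheory.

Local Open Scope classical_set_scope.
Local Open Scope quotient_scope.

(* `&` is intersection of sets; the meet of a semilattice is always written
   with the %O delimiter. *)

Section Filters.
Context {d : Order.disp_t} {A : tMeetSemilatticeType d}.

Definition is_filter (F : set A) : Prop :=
  [/\ F \top%O,
      forall a b : A, F a -> (a <= b)%O -> F b
    & forall a b : A, F a -> F b -> F (a `&` b)%O].

Definition irreducible_filter (P : set A) : Prop :=
  [/\ is_filter P, P <> [set: A]
    & ~ exists F1 F2 : set A,
          [/\ is_filter F1, is_filter F2, F1 <> P, F2 <> P & P = F1 `&` F2]].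

End Filters.

(* The set X(A), packaged as a type so that complements of subsets of X(A) are
   taken relative to X(A). *)
Record irrFilter (d : Order.disp_t) (A : tMeetSemilatticeType d) := IrrFilter {
  irr_carrier :> set A;
  irr_carrierP : irreducible_filter irr_carrier
}.

Definition beta (d : Order.disp_t) (A : tMeetSemilatticeType d) (a : A) :
  set (irrFilter A) := [set P : irrFilter A | (P : set A) a].

Definition minus_family (X : Type) (F : set (set X)) (U : set X) :
  set (set X) := [set Y | F Y /\ Y `&` U !=set0].

Definition theta_family (d : Order.disp_t) (A : tMeetSemilatticeType d)
    (F : set (set (irrFilter A))) : set (A * A) :=
  [set ab | minus_family F (~` beta ab.1) = minus_family F (~` beta ab.2)].

Definition irr_rel (d d' : Order.disp_t) (A : tMeetSemilatticeType d)
    (B : tMeetSemilatticeType d') (h : A -> B) :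
  set (irrFilter B * irrFilter A) :=
  [set QP : irrFilter B * irrFilter A | h @^-1` QP.1 `<=` QP.2].

Definition image_family (X Y : Type) (R : set (Y * X)) : set (set X) :=
  [set [set x | R (y, x)] | y in [set: Y]].

Record is_congruence (d : Order.disp_t) (A : tMeetSemilatticeType d)
    (theta : set (A * A)) : Prop := IsCongruence {
  cong_refl : forall a, theta (a, a);
  cong_sym : forall a b, theta (a, b) -> theta (b, a);
  cong_trans : forall a b c, theta (a, b) -> theta (b, c) -> theta (a, c);
  cong_meet : forall a b a' b', theta (a, b) -> theta (a', b') ->
    theta ((a `&` a')%O, (b `&` b')%O)
}.

Section Quotient.
Context (d : Order.disp_t) (A : tMeetSemilatticeType d) (theta : set (A * A)).
Context (cong : is_congruence theta).

Definition cong_rel : rel A := fun a b => `[< theta (a, b) >].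

Fact cong_rel_refl : reflexive cong_rel.
Proof. by move=> a; apply/asboolP; exact: (cong_refl cong). Qed.

Fact cong_rel_sym : symmetric cong_rel.
Proof. by move=> a b; apply/asboolP/asboolP; exact: (cong_sym cong). Qed.

Fact cong_rel_trans : transitive cong_rel.
Proof.
move=> b a c /asboolP ab /asboolP bc; apply/asboolP.
exact: (cong_trans cong) ab bc.
Qed.

Definition cong_equiv : equiv_rel A :=
  EquivRel cong_rel cong_rel_refl cong_rel_sym cong_rel_trans.

Definition quotient : Type := {eq_quot cong_equiv}.

HB.instance Definition _ := Choice.on quotient.
HB.instance Definition _ := EqQuotient.on quotient.

Definition quot_map (a : A) : quotient := \pi_quotient a.

Lemma quot_mapP (a b : A) : quot_map a = quot_map b <-> theta (a, b).
Proof.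
split=> [/eqmodP/asboolP //|ab]; by apply/eqmodP/asboolP.
Qed.

Definition quot_meet (x y : quotient) : quotient :=
  quot_map (repr x `&` repr y)%O.

Lemma quot_map_meet (a b : A) :
  quot_map (a `&` b)%O = quot_meet (quot_map a) (quot_map b).
Proof.
apply/quot_mapP; apply: (cong_meet cong); apply/quot_mapP;
  by rewrite /quot_map reprK.
Qed.

Lemma quot_map_surj (x : quotient) : exists a, x = quot_map a.
Proof. by exists (repr x); rewrite /quot_map reprK. Qed.

Definition quot_le (x y : quotient) : bool := quot_meet x y == x.

Fact quot_meetC : commutative quot_meet.
Proof. by move=> x y; rewrite /quot_meet meetC. Qed.

Fact quot_meetA : associative quot_meet.
Proof.
move=> x y z; have [a ->] := quot_map_surj x; have [b ->] := quot_map_surj y.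
by have [c ->] := quot_map_surj z; rewrite -!quot_map_meet meetA.
Qed.

Fact quot_le_refl : reflexive quot_le.
Proof. by move=> x; rewrite /quot_le /quot_meet meetxx /quot_map reprK. Qed.

Fact quot_le_anti : antisymmetric quot_le.
Proof.
by move=> x y /andP[/eqP xy /eqP yx]; rewrite -xy quot_meetC yx.
Qed.

Fact quot_le_trans : transitive quot_le.
Proof.
move=> y x z /eqP xy /eqP yz; apply/eqP.
by rewrite -xy -quot_meetA yz.
Qed.

HB.instance Definition _ :=
  Order.Le_isPOrder.Build d quotient quot_le_refl quot_le_anti quot_le_trans.

HB.instance Definition _ :=
  Order.POrder_Meet_isSemilattice.Build d quotient quot_meetC quot_meetA
    (fun x y => erefl).

Fact quot_lex1 (x : quotient) : (x <= quot_map \top)%O.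
Proof.
have [a ->] := quot_map_surj x; apply/eqP.
by rewrite -quot_map_meet meetx1.
Qed.

HB.instance Definition _ := Order.hasTop.Build d quotient quot_lex1.

End Quotient.

(* Main.v *)
Require Import Defs.
From mathcomp Require Import all_boot all_order.
From mathcomp Require Import boolp classical_sets.

(** By Zorn's lemma, an element outside a filter can be separated from it by an
    irreducible filter. Applied to the filter [q^-1[Q]] of [A], this shows that
    [R_q(Q)] meets the complement of [beta a] exactly when [q a] is not in [Q].
    Hence [a] and [b] are related by the right-hand side iff [q a] and [q b] lie
    in the same irreducible filters of [A/theta], which, by separation applied
    to principal filters, means [q a = q b]. *)

Import Order.TTheory.
Local Open Scope classical_set_scope.

Section Separation.
Context {d : Order.disp_t} {A : tMeetSemilatticeType d}.

Lemma is_filter_principal (a : A) : is_filter [set x | (a <= x)%O].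
Proof.
split=> [|x y /= ax xy|x y /= ax ay]; first exact: lex1.
- exact: le_trans ax xy.
- by rewrite lexI ax ay.
Qed.

(* [F] is kept as a separate member of the union so that [C] may be empty. *)
Lemma is_filter_bigcup_chain (F : set A) (C : set (set A)) :
    is_filter F -> (forall G, C G -> is_filter (F `|` G)) ->
    total_on C subset ->
  is_filter (F `|` \bigcup_(G in C) G).
Proof.
move=> [F1 Fup Fmeet] CF Ctot; split; first by left.
- move=> x y [Fx|[G CG Gx]] xy; first by left; exact: Fup Fx xy.
  have [_ up _] := CF G CG.
  by have [Fy|Gy] := up x y (or_intror Gx) xy; [left|right; exists G].
- have meetG G x y : C G -> (F `|` G) x -> (F `|` G) y ->
      (F `|` \bigcup_(G in C) G) (x `&` y)%O.
    move=> CG Gx Gy; have [_ _ meet] := CF G CG.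
    by have [Fxy|Gxy] := meet x y Gx Gy; [left|right; exists G].
  move=> x y [Fx|[G CG Gx]] [Fy|[H CH Hy]].
  + by left; exact: Fmeet.
  + by apply: (meetG H) => //; [left|right].
  + by apply: (meetG G) => //; [right|left].
  (* Of two members of the chain the larger one contains both elements. *)
  + have [GH|HG] := Ctot _ _ CG CH.
    * by apply: (meetG H) => //; right => //; exact: GH.
    * by apply: (meetG G) => //; right => //; exact: HG.
Qed.

(** If [M] were the intersection of two filters other than [M], both would strictly extend [M], so
    both would contain [a], and then so would [M]. *)
Lemma maximal_avoiding_irreducible (M : set A) (a : A) :
    is_filter M -> ~ M a ->
    (forall G, is_filter G -> M `<=` G -> G <> M -> G a) ->
  irreducible_filter M.
Proof.
move=> Mfilter Ma Mmax; split=> // [MT|]; first by apply: Ma; rewrite MT.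
move=> [F1 [F2 [F1filter F2filter F1M F2M MF]]]; apply: Ma; rewrite MF.
by split; apply: Mmax => //; rewrite MF => x [].
Qed.

Lemma irreducible_filter_separation (F : set A) (a : A) :
  is_filter F -> ~ F a -> exists2 P : irrFilter A, F `<=` P & ~ (P : set A) a.
Proof.
move=> Ffilter Fa.
(* [Zorn_bigcup] also asks for the union of the empty chain, which is empty; testing [F]|[G] instead
   of [G] makes the empty set a candidate and builds in the inclusion of [F]. *)
pose avoiding G := is_filter (F `|` G) /\ ~ (F `|` G) a.
have chain (C : set (set A)) : C `<=` avoiding -> total_on C subset ->
    avoiding (\bigcup_(G in C) G).
  move=> CP Ctot; split.
    by apply: is_filter_bigcup_chain => // G /CP[].
  by move=> [//|[G /CP[_ +] Ga]]; apply; right.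
have [G [[FGfilter FGa] Gmax]] := Zorn_bigcup chain.
have irr : irreducible_filter (F `|` G).
  apply: (@maximal_avoiding_irreducible _ a) => // H Hfilter FGH HFG.
  apply: contrapT => Ha.
  (* Since [H] contains [F], it is itself a candidate as soon as it omits [a], and it would strictly
     extend the maximal [G]. *)
  have FH : F `|` H = H by apply/setUidPr => x Fx; apply: FGH; left.
  apply: (Gmax H); last by rewrite /avoiding FH.
  split=> [x Gx|HG]; first by apply: FGH; right.
  by apply: HFG; apply/seteqP; split=> // x /HG; right.
by exists (IrrFilter irr) => // x Fx; left.
Qed.

Lemma irrFilter_separates_points (a b : A) :
  (forall P : irrFilter A, (P : set A) a <-> (P : set A) b) -> a = b.
Proof.
(* Antisymmetry reduces the claim to inequalities: if [x] is not below [y], the principal filter of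
   [x] omits [y]. *)
have le_sep x y :
    (forall P : irrFilter A, (P : set A) x -> (P : set A) y) -> (x <= y)%O.
  move=> xy; apply: contrapT => nle.
  have [P xP Py] := irreducible_filter_separation _ y (is_filter_principal x) nle.
  by apply/Py/xy/xP => /=.
by move=> ab; apply/le_anti/andP; split; apply: le_sep => P /ab.
Qed.

End Separation.

Section Quotient.
Context {d : Order.disp_t} {A : tMeetSemilatticeType d} {theta : set (A * A)}.
Context (cong : is_congruence theta).

Lemma is_filter_quot_preimage (Q : set (quotient cong)) :
  is_filter Q -> is_filter (quot_map cong @^-1` Q).
Proof.
move=> [Q1 Qup Qmeet]; split=> [//|a b /= Qa ab|a b /= Qa Qb].
(* The quotient order is defined by a meet equation, so monotonicity of the quotient map follows
   from its preserving meets. *)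
- by apply: Qup Qa _; apply/eqP; rewrite -quot_map_meet; move/meet_idPl: ab => ->.
- by rewrite quot_map_meet; exact: Qmeet.
Qed.

Lemma irr_rel_quot_meets_compl_beta (Q : irrFilter (quotient cong)) (a : A) :
  [set P | irr_rel (quot_map cong) (Q, P)] `&` ~` beta a !=set0 <->
  ~ (Q : set _) (quot_map cong a).
Proof.
split=> [[P [QP nPa] Qa]|nQa]; first by apply: nPa; exact: QP.
have [Qfilter _ _] := irr_carrierP Q.
have [P QP nPa] :=
  irreducible_filter_separation _ a (is_filter_quot_preimage _ Qfilter) nQa.
by exists P.
Qed.

End Quotient.

Theorem theorem13 (d : Order.disp_t) (A : tMeetSemilatticeType d)
    (theta : set (A * A)) (cong : is_congruence theta) :
  theta = theta_family (image_family (irr_rel (quot_map cong))).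
Proof.
apply/seteqP; split=> -[a b].
- move=> /(quot_mapP cong) ab; apply/seteqP.
  by split=> _ [[Q _ <-]] /irr_rel_quot_meets_compl_beta nQ;
    (split; first by exists Q); apply/irr_rel_quot_meets_compl_beta;
    move: nQ; rewrite /= ab.
- rewrite /theta_family /= => ab; apply/(quot_mapP cong).
  apply: irrFilter_separates_points => Q.
  have transfer x y :
      minus_family (image_family (irr_rel (quot_map cong))) (~` beta x) =
      minus_family (image_family (irr_rel (quot_map cong))) (~` beta y) ->
      (Q : set _) (quot_map cong x) -> (Q : set _) (quot_map cong y).
    move=> xy Qx; apply: contrapT => /irr_rel_quot_meets_compl_beta nQy.
    (* The set of all [P] related to [Q] is the member of the family that tells [x] and [y]
       apart. *)
    have : minus_family (image_family (irr_rel (quot_map cong))) (~` beta y)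
        [set P | irr_rel (quot_map cong) (Q, P)] by split=> //; exists Q.
    by rewrite -xy => -[_ /irr_rel_quot_meets_compl_beta].
  by split; apply: transfer.
Qed.
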